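(* Let $\mathbf{k}$ be a field and let $\rho\colon\mathbb{A}^2_{\mathbf{k}}\hookrightarrow\mathrm{SL}_2$, $(s,t)\mapsto\begin{pmatrix}f_{11}(s,t) & f_{12}(s,t)\\ f_{21}(s,t) & f_{22}(s,t)\end{pmatrix}$, be a closed embedding such that $f_{11},f_{12},f_{21},f_{22}\in\mathbf{k}[s,t]$ have degree at most $2$. Then $\rho$ is equivalent to the embedding $\rho_\lambda\colon\mathbb{A}^2_{\mathbf{k}}\hookrightarrow\mathrm{SL}_2$, $(s,t)\mapsto\begin{pmatrix}1 & t\\ \lambda s & 1+\lambda st\end{pmatrix}$, for some $\lambda\in\mathbf{k}^*$.
   Context: $\mathrm{SL}_2=\operatorname{Spec}(\mathbf{k}[t,u,x,y]/(xy-tu-1))$, with points written as matrices $\begin{pmatrix}x & t\\ u & y\end{pmatrix}$. Degree means total degree in $s,t$. Two closed embeddings $\rho,\rho'\colon X\hookrightarrow Y$ are equivalent if there is an automorphism $\varphi$ of the $\mathbf{k}$-variety $Y$ with $\rho'=\varphi\circ\rho$. *)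

(* Defs.v *)
From HB Require Import structures.
From mathcomp Require Import all_boot all_algebra generic_quotient ring_quotient.
From mathcomp Require Import boolp mpoly.

Set Implicit Arguments.
Unset Strict Implicit.
Unset Printing Implicit Defensive.
Set Warnings "-redundant-canonical-projection".

Import GRing.Theory.
Local Open Scope ring_scope.
Local Open Scope quotient_scope.

(* Affine k-varieties are given by their coordinate rings: a morphism X -> Y is
   a homomorphism of k-algebras k[Y] -> k[X] (its comorphism).  It is a closed
   embedding when the comorphism is onto, and an automorphism of Y is a
   bijective comorphism k[Y] -> k[Y]. *)
Section Embeddings.

Variables (k : fieldType) (kX kY : comAlgType k).

Definition closed_embedding (rho : {lrmorphism kY -> kX}) : Prop :=
  forall p : kX, exists q : kY, rho q = p.

(* The comorphism of phi \o rho is rho^* \o phi^*, whence the order below. *)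
Definition equivalent_embeddings (rho rho' : {lrmorphism kY -> kX}) : Prop :=
  exists phi : {lrmorphism kY -> kY}, bijective phi /\ rho' =1 rho \o phi.

End Embeddings.

Section SL2.

Variable k : fieldType.

(* The variables t, u, x, y of k[t, u, x, y] are numbered 0, 1, 2, 3. *)
Definition var_t : {mpoly k[4]} := 'X_(inord 0).
Definition var_u : {mpoly k[4]} := 'X_(inord 1).
Definition var_x : {mpoly k[4]} := 'X_(inord 2).
Definition var_y : {mpoly k[4]} := 'X_(inord 3).

Definition SL2_eqn : {mpoly k[4]} := var_x * var_y - var_t * var_u - 1.

Definition SL2_ideal : {pred {mpoly k[4]}} :=
  fun p => `[< exists q, p = q * SL2_eqn >].

Lemma SL2_idealP p : reflect (exists q, p = q * SL2_eqn) (p \in SL2_ideal).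
Proof. exact: asboolP. Qed.

Fact SL2_ideal_closed : idealr_closed SL2_ideal.
Proof.
split.
- by apply/SL2_idealP; exists 0; rewrite mul0r.
- apply/negP => /SL2_idealP[q /(congr1 (meval (fun i => (1 < i)%N%:R)))].
  rewrite mevalM meval1 /SL2_eqn !mevalB !mevalM !mevalXU meval1 !inordK //=.
  by rewrite mulr1 mul0r subr0 subrr mulr0 => /eqP; rewrite oner_eq0.
- move=> a p q /SL2_idealP[p' ->] /SL2_idealP[q' ->]; apply/SL2_idealP.
  by exists (a * p' + q'); rewrite mulrDl mulrA.
Qed.

HB.instance Definition _ := isIdealr.Build {mpoly k[4]} SL2_ideal SL2_ideal_closed.

Definition kSL2 : Type := {ideal_quot SL2_ideal}.

HB.instance Definition _ := GRing.ComNzRing.on kSL2.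

Definition SL2_class : {mpoly k[4]} -> kSL2 := \pi_{ideal_quot SL2_ideal}.

HB.instance Definition _ := GRing.RMorphism.on SL2_class.

Lemma SL2_class_surj (a : kSL2) : exists p, SL2_class p = a.
Proof. by exists (repr a); exact: reprK. Qed.

Lemma SL2_class_eq p q : SL2_class p = SL2_class q <-> p - q \in SL2_ideal.
Proof. by rewrite (Quotient.idealrBE SL2_ideal); split=> /eqP. Qed.

Definition SL2_scale (c : k) (a : kSL2) : kSL2 := SL2_class c%:MP * a.

Fact SL2_scaleA a b v : SL2_scale a (SL2_scale b v) = SL2_scale (a * b) v.
Proof. by rewrite /SL2_scale mulrA -rmorphM /= mpolyCM. Qed.

Fact SL2_scale1 : left_id 1 SL2_scale.
Proof. by move=> v; rewrite /SL2_scale mpolyC1 rmorph1 mul1r. Qed.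

Fact SL2_scaleDr : right_distributive SL2_scale +%R.
Proof. by move=> c u v; rewrite /SL2_scale mulrDr. Qed.

Fact SL2_scaleDl v : {morph SL2_scale^~ v : a b / a + b}.
Proof. by move=> a b; rewrite /SL2_scale mpolyCD rmorphD mulrDl. Qed.

HB.instance Definition _ :=
  GRing.Zmodule_isLmodule.Build k kSL2 SL2_scaleA SL2_scale1 SL2_scaleDr SL2_scaleDl.

Fact SL2_scaleAl (c : k) (u v : kSL2) : c *: (u * v) = (c *: u) * v.
Proof. exact: mulrA. Qed.

HB.instance Definition _ := GRing.Lmodule_isLalgebra.Build k kSL2 SL2_scaleAl.
HB.instance Definition _ := GRing.Lalgebra_isComAlgebra.Build k kSL2.

Fact SL2_class_scalable : scalable SL2_class.
Proof. by move=> c p; rewrite -mul_mpolyC rmorphM. Qed.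

HB.instance Definition _ :=
  GRing.isScalable.Build k {mpoly k[4]} kSL2 *:%R SL2_class SL2_class_scalable.

Definition mx2 (A : Type) (a11 a12 a21 a22 : A) : 'M[A]_2 :=
  \matrix_(i < 2, j < 2)
    if i == 0 then (if j == 0 then a11 else a12)
              else (if j == 0 then a21 else a22).

Lemma mx2E (A : Type) (M : 'M[A]_2) : M = mx2 (M 0 0) (M 0 1) (M 1 0) (M 1 1).
Proof.
by apply/matrixP => -[[|[|//]] i] -[[|[|//]] j]; rewrite mxE /=;
  congr (M _ _); apply: val_inj.
Qed.

Lemma det_mx2 (A : comNzRingType) (a11 a12 a21 a22 : A) :
  \det (mx2 a11 a12 a21 a22) = a11 * a22 - a12 * a21.
Proof.
rewrite (expand_det_row _ 0) !big_ord_recl big_ord0 addr0 /cofactor !det_mx11.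
by rewrite !mxE /= expr0 expr1 mul1r mulN1r mulrN.
Qed.

Definition SL2_coord : 'M[kSL2]_2 :=
  mx2 (SL2_class var_x) (SL2_class var_t) (SL2_class var_u) (SL2_class var_y).

Fact SL2_class_eqn :
  SL2_class var_x * SL2_class var_y - SL2_class var_t * SL2_class var_u = 1.
Proof.
have classM p q : SL2_class p * SL2_class q = SL2_class (p * q).
  exact/esym/(rmorphM SL2_class).
have classB p q : SL2_class p - SL2_class q = SL2_class (p - q).
  exact/esym/(rmorphB SL2_class).
have -> : 1 = SL2_class 1 by exact/esym/(rmorph1 SL2_class).
rewrite !classM classB.
by apply/SL2_class_eq/SL2_idealP; exists 1; rewrite mul1r.
Qed.

Lemma det_SL2_coord : \det SL2_coord = 1.
Proof. by rewrite det_mx2; exact: SL2_class_eqn. Qed.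

Section Morphisms.

Variable A : comAlgType k.

(* The four regular functions on X = Spec A defining a morphism X -> SL_2. *)
Definition mx_of_mor (rho : {lrmorphism kSL2 -> A}) : 'M[A]_2 :=
  map_mx rho SL2_coord.

Lemma det_mx_of_mor rho : \det (mx_of_mor rho) = 1.
Proof. by rewrite det_map_mx det_SL2_coord rmorph1. Qed.

Definition SL2_subst (M : 'M[A]_2) (i : 'I_4) : A :=
  nth 0 [:: M 0 1; M 1 0; M 0 0; M 1 1] i.

(* The proof detM does not occur in the value; it makes the map a morphism. *)
Definition mor_of_mx (M : 'M[A]_2) (detM : \det M = 1) (a : kSL2) : A :=
  mmap (in_alg A) (SL2_subst M) (repr a).

Section OfMatrix.

Variables (M : 'M[A]_2) (detM : \det M = 1).

Fact mor_of_mx_class p :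
  mor_of_mx detM (SL2_class p) = mmap (in_alg A) (SL2_subst M) p.
Proof.
have /SL2_class_eq/SL2_idealP[q eq_q] : SL2_class (repr (SL2_class p)) = SL2_class p.
  exact: reprK.
apply/eqP; rewrite -subr_eq0 /mor_of_mx -mmapB eq_q rmorphM /=.
rewrite /SL2_eqn !rmorphB !rmorphM rmorph1 /= !mmapX !mmap1U.
rewrite /SL2_subst !inordK //= -detM [M in \det M]mx2E det_mx2.
by rewrite [M 0 0 * _ - _]lock subrr mulr0.
Qed.

Fact mor_of_mx_zmod : zmod_morphism (mor_of_mx detM).
Proof.
move=> a b; have [p <-] := SL2_class_surj a; have [q <-] := SL2_class_surj b.
by rewrite -rmorphB !mor_of_mx_class rmorphB.
Qed.

Fact mor_of_mx_monoid : monoid_morphism (mor_of_mx detM).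
Proof.
split=> [|a b]; first by rewrite -(rmorph1 SL2_class) mor_of_mx_class rmorph1.
have [p <-] := SL2_class_surj a; have [q <-] := SL2_class_surj b.
by rewrite -rmorphM !mor_of_mx_class rmorphM.
Qed.

Fact mor_of_mx_scalable : scalable (mor_of_mx detM).
Proof.
move=> c a; have [p <-] := SL2_class_surj a.
by rewrite -linearZ /= !mor_of_mx_class mmapZ /= mulr_algl.
Qed.

HB.instance Definition _ :=
  GRing.isZmodMorphism.Build kSL2 A (mor_of_mx detM) mor_of_mx_zmod.
HB.instance Definition _ :=
  GRing.isMonoidMorphism.Build kSL2 A (mor_of_mx detM) mor_of_mx_monoid.
HB.instance Definition _ :=
  GRing.isScalable.Build k kSL2 A *:%R (mor_of_mx detM) mor_of_mx_scalable.

Lemma mx_of_morK : mx_of_mor (mor_of_mx detM) = M.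
Proof.
rewrite [M in RHS]mx2E [LHS]mx2E !mxE /= !mor_of_mx_class !mmapX !mmap1U.
by rewrite /SL2_subst !inordK.
Qed.

End OfMatrix.

Lemma mx_of_mor_inj (rho rho' : {lrmorphism kSL2 -> A}) :
  mx_of_mor rho = mx_of_mor rho' -> rho =1 rho'.
Proof.
move=> eq_mx a; have [p <-] := SL2_class_surj a.
have eq_coord i j : rho (SL2_coord i j) = rho' (SL2_coord i j).
  by have /matrixP/(_ i j) := eq_mx; rewrite !mxE.
elim/mpolyind: p => [|c m p _ _ IHp]; first by rewrite !rmorph0.
rewrite !rmorphD /= {}IHp !linearZ /=; congr (_ *: _ + _).
rewrite mpolyXE_id !rmorph_prod; apply: eq_bigr => i _; rewrite !rmorphXn.
congr (_ ^+ _).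
have -> : i = inord i by rewrite inord_val.
move: (eq_coord 0 1) (eq_coord 1 0) (eq_coord 0 0) (eq_coord 1 1).
by rewrite !mxE /=; case: i => [[|[|[|[|//]]]]].
Qed.

End Morphisms.

Section Rho.

Variable lambda : k.

Let s : {mpoly k[2]} := 'X_0.
Let t : {mpoly k[2]} := 'X_1.

Definition rho_mx : 'M[{mpoly k[2]}]_2 :=
  mx2 1 t (lambda *: s) (1 + lambda *: (s * t)).

Fact det_rho_mx : \det rho_mx = 1.
Proof. by rewrite det_mx2 mul1r -scalerAr [t * s]mulrC addrK. Qed.

Definition rho_embedding : {lrmorphism kSL2 -> {mpoly k[2]}} :=
  mor_of_mx det_rho_mx.

End Rho.

End SL2.

(* Main.v *)
Require Import Defs.
From HB Require Import structures.
From mathcomp Require Import all_boot all_algebra generic_quotient ring_quotient.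
From mathcomp Require Import boolp mpoly ring.

Set Implicit Arguments.
Unset Strict Implicit.
Unset Printing Implicit Defensive.

Import GRing.Theory.
Local Open Scope ring_scope.

(** Write [rho] as a matrix [M = s^2 A0 + s t A1 + t^2 A2 + s B0 + t B1 + C] with
    coefficients in ['M[k]_2].  Its quadratic part has determinant zero.  If no
    constant column vector kills it on the right and no constant row vector on
    the left, it is the product of a column and a row of linear forms; comparing
    coefficients in [det M = 1] then shows that, after translating [(s, t)], [M]
    has no linear part, so both partial derivatives of [M] vanish at a point
    and [rho] is not an immersion.  (The model case is
    [[s^2, s t + 1], [s t - 1, t^2]], which factors through [A^2 / {1, -1}].)
    Otherwise multiplication by a constant matrix and a transposition make the
    first row affine.  Having no zero, this row becomes [(1, a)] after a further
    constant multiplication, and [a], [b = f21] are then affine coordinates.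
    Shears of [SL_2] act on [(a, b)] by elementary transformations, which bring
    it to [(t, lambda s)]. *)

(** * Matrices of quadratic polynomials in two elements of an algebra *)

Lemma ord2P (i : 'I_2) : {i = 0} + {i = 1}.
Proof. by case: i => [[|[|//]] Hi]; [left|right]; exact: val_inj. Qed.

Section QuadraticMatrices.

Variables (k : fieldType) (A : comAlgType k).

Local Notation const := (map_mx (in_alg A)).

(** The arguments range over any algebra, so the same coefficients can be evaluated at [s] and [t],
    at a translate, at a constant point or along a line. *)
Definition qmx (A0 A1 A2 B0 B1 C : 'M[k]_2) (x y : A) : 'M[A]_2 :=
  x ^+ 2 *: const A0 + (x * y) *: const A1 + y ^+ 2 *: const A2
  + x *: const B0 + y *: const B1 + const C.

Lemma qmxE A0 A1 A2 B0 B1 C x y i j :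
  qmx A0 A1 A2 B0 B1 C x y i j =
  x ^+ 2 * (A0 i j)%:A + x * y * (A1 i j)%:A + y ^+ 2 * (A2 i j)%:A
  + x * (B0 i j)%:A + y * (B1 i j)%:A + (C i j)%:A.
Proof. by rewrite !mxE. Qed.

Lemma mul_qmx P A0 A1 A2 B0 B1 C Q x y :
  const P *m qmx A0 A1 A2 B0 B1 C x y *m const Q =
  qmx (P *m A0 *m Q) (P *m A1 *m Q) (P *m A2 *m Q) (P *m B0 *m Q)
      (P *m B1 *m Q) (P *m C *m Q) x y.
Proof. by rewrite /qmx !map_mxM !(mulmxDr, mulmxDl) -!(scalemxAr, scalemxAl). Qed.

Lemma tr_qmx A0 A1 A2 B0 B1 C x y :
  (qmx A0 A1 A2 B0 B1 C x y)^T = qmx A0^T A1^T A2^T B0^T B1^T C^T x y.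
Proof. by apply/matrixP => i j; rewrite [LHS]mxE !qmxE !mxE. Qed.

(** Taylor expansion at [(a, b)]: the new linear coefficients are the partial derivatives there, the
    new constant term is the value. *)
Lemma qmx_shift A0 A1 A2 B0 B1 C (a b : k) x y :
  qmx A0 A1 A2 B0 B1 C (x + a%:A) (y + b%:A) =
  qmx A0 A1 A2 (B0 + (a *+ 2) *: A0 + b *: A1) (B1 + a *: A1 + (b *+ 2) *: A2)
      (C + a ^+ 2 *: A0 + (a * b) *: A1 + b ^+ 2 *: A2 + a *: B0 + b *: B1) x y.
Proof.
apply/matrixP => i j; rewrite !qmxE !mxE -!in_algE.
rewrite !(rmorphD, rmorphM, rmorphMn, rmorphXn).
ring.
Qed.

Lemma qmx_swap A0 A1 A2 B0 B1 C x y :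
  qmx A0 A1 A2 B0 B1 C x y = qmx A2 A1 A0 B1 B0 C y x.
Proof. by apply/matrixP => i j; rewrite !qmxE; ring. Qed.

End QuadraticMatrices.

Lemma map_qmx (k : fieldType) (A B : comAlgType k) (h : {lrmorphism A -> B})
    A0 A1 A2 B0 B1 C x y :
  map_mx h (qmx A0 A1 A2 B0 B1 C x y) = qmx A0 A1 A2 B0 B1 C (h x) (h y).
Proof.
apply/matrixP => i j; rewrite mxE !qmxE !expr2 !(rmorphD, rmorphM) /=.
by rewrite !rmorph_alg.
Qed.

(** All exponents are written out, zeros included, so that [mcoeff_mon] applies to every term. *)
Lemma quad_monomials (R : comNzRingType) (a20 a11 a02 a10 a01 a00 x y : R) :
  x ^+ 2 * a20 + x * y * a11 + y ^+ 2 * a02 + x * a10 + y * a01 + a00 =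
  a20 * x ^+ 2 * y ^+ 0 + a11 * x ^+ 1 * y ^+ 1 + a02 * x ^+ 0 * y ^+ 2
  + a10 * x ^+ 1 * y ^+ 0 + a01 * x ^+ 0 * y ^+ 1 + a00 * x ^+ 0 * y ^+ 0.
Proof. by ring. Qed.

Lemma quad_selector (R : comNzRingType) (c : nat -> nat -> R) (i j : nat) :
  ((2 < i + j)%N -> c i j = 0) ->
  c i j =
  c 2 0 * ((2 == i) && (0 == j))%:R + c 1 1 * ((1 == i) && (1 == j))%:R
  + c 0 2 * ((0 == i) && (2 == j))%:R + c 1 0 * ((1 == i) && (0 == j))%:R
  + c 0 1 * ((0 == i) && (1 == j))%:R + c 0 0 * ((0 == i) && (0 == j))%:R.
Proof.
by case: i j => [|[|[|i]]] [|[|[|j]]] c0 /=;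
  rewrite !(mulr0, mulr1, addr0, add0r) //; exact: c0.
Qed.

(** * Determinant of a quadratic matrix *)

Section DetCoefs.

Variable k : fieldType.

(** The polarization of the determinant: [\det (X + Y) = \det X + ddet X Y + \det Y]. *)
Definition ddet (X Y : 'M[k]_2) :=
  X 0 0 * Y 1 1 + Y 0 0 * X 1 1 - X 0 1 * Y 1 0 - Y 0 1 * X 1 0.

Lemma det2E (R : comNzRingType) (X : 'M[R]_2) :
  \det X = X 0 0 * X 1 1 - X 0 1 * X 1 0.
Proof. by rewrite [X in LHS]mx2E det_mx2. Qed.

Lemma det_qmxE (A : comAlgType k) A0 A1 A2 B0 B1 C (x y : A) :
  \det (qmx A0 A1 A2 B0 B1 C x y) =
  (\det A0)%:A * x ^+ 4 * y ^+ 0 + (ddet A0 A1)%:A * x ^+ 3 * y ^+ 1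
  + (\det A1 + ddet A0 A2)%:A * x ^+ 2 * y ^+ 2
  + (ddet A1 A2)%:A * x ^+ 1 * y ^+ 3 + (\det A2)%:A * x ^+ 0 * y ^+ 4
  + (ddet A0 B0)%:A * x ^+ 3 * y ^+ 0
  + (ddet A0 B1 + ddet A1 B0)%:A * x ^+ 2 * y ^+ 1
  + (ddet A1 B1 + ddet A2 B0)%:A * x ^+ 1 * y ^+ 2
  + (ddet A2 B1)%:A * x ^+ 0 * y ^+ 3
  + (\det B0 + ddet A0 C)%:A * x ^+ 2 * y ^+ 0
  + (ddet B0 B1 + ddet A1 C)%:A * x ^+ 1 * y ^+ 1
  + (\det B1 + ddet A2 C)%:A * x ^+ 0 * y ^+ 2
  + (ddet B0 C)%:A * x ^+ 1 * y ^+ 0 + (ddet B1 C)%:A * x ^+ 0 * y ^+ 1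
  + (\det C)%:A * x ^+ 0 * y ^+ 0.
Proof.
rewrite !det2E !qmxE /ddet -!in_algE !(rmorphB, rmorphD, rmorphM).
ring.
Qed.

End DetCoefs.

(** * Coefficients and substitution in [k[s, t]] *)

Section BivariatePolynomials.

Variable k : fieldType.

Local Notation s := ('X_0 : {mpoly k[2]}).
Local Notation t := ('X_1 : {mpoly k[2]}).

Definition mon (i j : nat) : 'X_{1..2} := [multinom of [:: i; j]].

Lemma mon_0 i j : mon i j 0 = i. Proof. exact: (mnm_nth 0). Qed.

Lemma mon_1 i j : mon i j 1 = j. Proof. exact: (mnm_nth 0). Qed.

Lemma mon_eq i j i' j' : (mon i j == mon i' j') = (i == i') && (j == j').
Proof.
apply/eqP/andP => [/mnmP eq_m | [/eqP-> /eqP->] //].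
by move: (eq_m 0) (eq_m 1); rewrite !mon_0 !mon_1 => -> ->.
Qed.

Lemma monE (m : 'X_{1..2}) : m = mon (m 0) (m 1).
Proof. by apply/mnmP => i; case: (ord2P i) => ->; rewrite ?mon_0 ?mon_1. Qed.

Lemma mdeg_mon i j : mdeg (mon i j) = (i + j)%N.
Proof.
rewrite mdegE big_ord_recl big_ord1 [mon i j ord0]mon_0.
by have -> : lift ord0 ord0 = 1 :> 'I_2 by [exact: val_inj]; rewrite mon_1.
Qed.

Lemma monX i j : s ^+ i * t ^+ j = 'X_[mon i j].
Proof.
rewrite [RHS]mpolyXE_id big_ord_recl big_ord1 [mon i j ord0]mon_0.
by have -> : lift ord0 ord0 = 1 :> 'I_2 by [exact: val_inj]; rewrite mon_1.
Qed.

Lemma mcoeff_mon c i j i' j' :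
  (c%:A * s ^+ i * t ^+ j)@_(mon i' j') = c * ((i == i') && (j == j'))%:R.
Proof. by rewrite -mulrA mulr_algl mcoeffZ monX mcoeffX mon_eq. Qed.

(** [msize] is the total degree plus one, so the bound 3 means degree at most 2. *)
Lemma quad_coefE (f : {mpoly k[2]}) : (msize f <= 3)%N ->
  f = s ^+ 2 * (f@_(mon 2 0))%:A + s * t * (f@_(mon 1 1))%:A
      + t ^+ 2 * (f@_(mon 0 2))%:A + s * (f@_(mon 1 0))%:A
      + t * (f@_(mon 0 1))%:A + (f@_(mon 0 0))%:A.
Proof.
move=> szf; rewrite quad_monomials; apply/mpolyP => m.
rewrite (monE m) !(mcoeffD, mcoeff_mon).
apply: (quad_selector (c := fun i j => f@_(mon i j))) => lt_m.
by apply/memN_msupp_eq0/msize_mdeg_ge; rewrite mdeg_mon; apply: leq_trans szf _.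
Qed.

Lemma quad_qmx (M : 'M[{mpoly k[2]}]_2) :
    (forall i j, msize (M i j) <= 3)%N ->
  exists A0 A1 A2 B0 B1 C, M = qmx A0 A1 A2 B0 B1 C s t.
Proof.
move=> szM; pose coefs i j := map_mx (fun f => f@_(mon i j)) M.
exists (coefs 2 0), (coefs 1 1), (coefs 0 2), (coefs 1 0), (coefs 0 1), (coefs 0 0).
by apply/matrixP => i j; rewrite qmxE !mxE; exact: quad_coefE.
Qed.

(** The fifteen monomials of degree at most 4 are linearly independent. The constant [delta] is
    arbitrary because normalizing [A0] later rescales the determinant. *)
Lemma quartic_eq_const (a40 a31 a22 a13 a04 a30 a21 a12 a03 a20 a11 a02 a10
    a01 a00 delta : k) :
    a40%:A * s ^+ 4 * t ^+ 0 + a31%:A * s ^+ 3 * t ^+ 1 + a22%:A * s ^+ 2 * t ^+ 2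
    + a13%:A * s ^+ 1 * t ^+ 3 + a04%:A * s ^+ 0 * t ^+ 4 + a30%:A * s ^+ 3 * t ^+ 0
    + a21%:A * s ^+ 2 * t ^+ 1 + a12%:A * s ^+ 1 * t ^+ 2 + a03%:A * s ^+ 0 * t ^+ 3
    + a20%:A * s ^+ 2 * t ^+ 0 + a11%:A * s ^+ 1 * t ^+ 1 + a02%:A * s ^+ 0 * t ^+ 2
    + a10%:A * s ^+ 1 * t ^+ 0 + a01%:A * s ^+ 0 * t ^+ 1 + a00%:A * s ^+ 0 * t ^+ 0
    = delta%:A ->
  [/\ [/\ a40 = 0, a31 = 0, a22 = 0, a13 = 0 & a04 = 0],
      [/\ a30 = 0, a21 = 0, a12 = 0 & a03 = 0],
      [/\ a20 = 0, a11 = 0 & a02 = 0]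
    & [/\ a10 = 0, a01 = 0 & a00 = delta]].
Proof.
have -> : delta%:A = delta%:A * s ^+ 0 * t ^+ 0 by rewrite !expr0 !mulr1.
move=> eq_f; pose sel (a b i j : nat) : k := ((a == i) && (b == j))%:R.
have coef i j :
    a40 * sel 4 0 i j + a31 * sel 3 1 i j + a22 * sel 2 2 i j
    + a13 * sel 1 3 i j + a04 * sel 0 4 i j + a30 * sel 3 0 i j
    + a21 * sel 2 1 i j + a12 * sel 1 2 i j + a03 * sel 0 3 i j
    + a20 * sel 2 0 i j + a11 * sel 1 1 i j + a02 * sel 0 2 i j
    + a10 * sel 1 0 i j + a01 * sel 0 1 i j + a00 * sel 0 0 i j
    = delta * sel 0 0 i j.
  by move/(congr1 (mcoeff (mon i j))): eq_f; rewrite !(mcoeffD, mcoeff_mon).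
have simp := (mulr1, mulr0, addr0, add0r); move: coef {eq_f}; rewrite {}/sel => coef.
split; split;
  [ move: (coef 4%N 0%N) | move: (coef 3%N 1%N) | move: (coef 2%N 2%N)
  | move: (coef 1%N 3%N) | move: (coef 0%N 4%N) | move: (coef 3%N 0%N)
  | move: (coef 2%N 1%N) | move: (coef 1%N 2%N) | move: (coef 0%N 3%N)
  | move: (coef 2%N 0%N) | move: (coef 1%N 1%N) | move: (coef 0%N 2%N)
  | move: (coef 1%N 0%N) | move: (coef 0%N 1%N) | move: (coef 0%N 0%N)];
  by rewrite /= !simp.
Qed.

Lemma det_qmx_coefs A0 A1 A2 B0 B1 C (delta : k) :
    \det (qmx A0 A1 A2 B0 B1 C s t) = delta%:A ->
  [/\ [/\ \det A0 = 0, ddet A0 A1 = 0, \det A1 + ddet A0 A2 = 0,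
          ddet A1 A2 = 0 & \det A2 = 0],
      [/\ ddet A0 B0 = 0, ddet A0 B1 + ddet A1 B0 = 0,
          ddet A1 B1 + ddet A2 B0 = 0 & ddet A2 B1 = 0],
      [/\ \det B0 + ddet A0 C = 0, ddet B0 B1 + ddet A1 C = 0
        & \det B1 + ddet A2 C = 0]
    & [/\ ddet B0 C = 0, ddet B1 C = 0 & \det C = delta]].
Proof. by rewrite det_qmxE; exact: quartic_eq_const. Qed.

Definition subst2 (A : comAlgType k) (x y : A) : {mpoly k[2]} -> A :=
  mmap (in_alg A) (fun i => if i == 0 then x else y).

Section Substitution.

Variables (A : comAlgType k) (x y : A).

HB.instance Definition _ := GRing.RMorphism.on (subst2 x y).

Fact subst2_scalable : scalable (subst2 x y).
Proof. by move=> c p; rewrite /subst2 mmapZ mulr_algl. Qed.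
HB.instance Definition _ :=
  GRing.isScalable.Build k {mpoly k[2]} A *:%R (subst2 x y) subst2_scalable.

Lemma subst2_s : subst2 x y s = x.
Proof. by rewrite /subst2 mmapX mmap1U. Qed.

Lemma subst2_t : subst2 x y t = y.
Proof. by rewrite /subst2 mmapX mmap1U. Qed.

Lemma subst2_qmx A0 A1 A2 B0 B1 C :
  map_mx (subst2 x y) (qmx A0 A1 A2 B0 B1 C s t) = qmx A0 A1 A2 B0 B1 C x y.
Proof. by rewrite map_qmx /= subst2_s subst2_t. Qed.

Lemma det_qmx_subst A0 A1 A2 B0 B1 C delta :
  \det (qmx A0 A1 A2 B0 B1 C s t) = delta%:A ->
  \det (qmx A0 A1 A2 B0 B1 C x y) = delta%:A.
Proof.
by move=> detM; rewrite -subst2_qmx det_map_mx detM /= rmorph_alg.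
Qed.

End Substitution.

End BivariatePolynomials.

(** * Quadratic matrices of nonzero constant determinant *)

Section Trichotomy.

Variable k : fieldType.

Local Notation s := ('X_0 : {mpoly k[2]}).
Local Notation t := ('X_1 : {mpoly k[2]}).

Implicit Types A B C P Q X : 'M[k]_2.

Lemma mx2P X : X 0 0 = 0 -> X 0 1 = 0 -> X 1 0 = 0 -> X 1 1 = 0 -> X = 0.
Proof.
move=> X00 X01 X10 X11; apply/matrixP => i j; rewrite mxE.
by case: (ord2P i) (ord2P j) => -> [] ->.
Qed.

(* The last alternative says that both partial derivatives of [qmx] vanish at
   the point [(a, b)]. *)
Definition degenerate A0 A1 A2 B0 B1 : Prop :=
  [\/ exists2 v : 'rV[k]_2, v != 0 &
        [/\ v *m A0 = 0, v *m A1 = 0 & v *m A2 = 0],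
      exists2 w : 'cV[k]_2, w != 0 &
        [/\ A0 *m w = 0, A1 *m w = 0 & A2 *m w = 0]
    | exists a b, B0 + (a *+ 2) *: A0 + b *: A1 = 0 /\
                  B1 + a *: A1 + (b *+ 2) *: A2 = 0].

(** A null row is carried back by [P], a null column by [Q], and the critical point [(a, b)] stays
    the same. *)
Lemma degenerate_equiv P Q A0 A1 A2 B0 B1 : P \in unitmx -> Q \in unitmx ->
  degenerate (P *m A0 *m Q) (P *m A1 *m Q) (P *m A2 *m Q)
             (P *m B0 *m Q) (P *m B1 *m Q) ->
  degenerate A0 A1 A2 B0 B1.
Proof.
move=> uP uQ [[v nz_v [vA0 vA1 vA2]]|[w nz_w [A0w A1w A2w]]|[a [b [eq0 eq1]]]].
- have Q0 X : v *m (P *m X *m Q) = 0 -> v *m P *m X = 0.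
    by move=> vX; rewrite -[LHS](mulmxK uQ) -(mulmxA v) -(mulmxA v) vX mul0mx.
  apply: Or31; exists (v *m P); last by split; exact: Q0.
  by apply: contra nz_v => /eqP vP; rewrite -[v](mulmxK uP) vP mul0mx.
- have P0 X : P *m X *m Q *m w = 0 -> X *m (Q *m w) = 0.
    move=> Xw; rewrite -[LHS](mulKmx uP) (mulmxA X) (mulmxA P) (mulmxA P) Xw.
    by rewrite mulmx0.
  apply: Or32; exists (Q *m w); last by split; exact: P0.
  by apply: contra nz_w => /eqP Qw; rewrite -[w](mulKmx uQ) Qw mulmx0.
- have PQ0 X : P *m X *m Q = 0 -> X = 0.
    by move=> PXQ; rewrite -[X](mulKmx uP) -[P *m X](mulmxK uQ) PXQ mul0mx mulmx0.
  apply: Or33; exists a, b; split; apply: PQ0.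
    by rewrite !(mulmxDr, mulmxDl) -!(scalemxAr, scalemxAl).
  by rewrite !(mulmxDr, mulmxDl) -!(scalemxAr, scalemxAl).
Qed.

Lemma degenerate_swap A0 A1 A2 B0 B1 :
  degenerate A2 A1 A0 B1 B0 -> degenerate A0 A1 A2 B0 B1.
Proof.
case=> [[v nz_v [vA0 vA1 vA2]]|[w nz_w [A0w A1w A2w]]|[a [b [eq0 eq1]]]].
- by apply: Or31; exists v.
- by apply: Or32; exists w.
- by apply: Or33; exists b, a; split; rewrite addrAC.
Qed.

Lemma row1_degenerate A0 A1 A2 B0 B1 :
  (forall X, X \in [:: A0; A1; A2] -> X 1 0 = 0 /\ X 1 1 = 0) ->
  degenerate A0 A1 A2 B0 B1.
Proof.
move=> row0; apply: Or31; exists (delta_mx 0 1).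
  by apply/eqP => /matrixP/(_ 0 1)/eqP; rewrite !mxE !eqxx oner_eq0.
have eq0 X : X \in [:: A0; A1; A2] -> delta_mx (0 : 'I_1) 1 *m X = 0.
  move=> /row0[X10 X11]; rewrite -rowE; apply/rowP => j; rewrite !mxE.
  by case: (ord2P j) => ->.
by split; apply: eq0; rewrite !inE eqxx ?orbT.
Qed.

Lemma col1_degenerate A0 A1 A2 B0 B1 :
  (forall X, X \in [:: A0; A1; A2] -> X 0 1 = 0 /\ X 1 1 = 0) ->
  degenerate A0 A1 A2 B0 B1.
Proof.
move=> col0; apply: Or32; exists (delta_mx 1 0).
  by apply/eqP => /matrixP/(_ 1 0)/eqP; rewrite !mxE !eqxx oner_eq0.
have eq0 X : X \in [:: A0; A1; A2] -> X *m delta_mx 1 (0 : 'I_1) = 0.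
  move=> /col0[X01 X11]; rewrite -colE; apply/colP => j; rewrite !mxE.
  by case: (ord2P j) => ->.
by split; apply: eq0; rewrite !inE eqxx ?orbT.
Qed.

(** For this [A0], [ddet A0 X] is just [X 1 1], so the coefficients of the determinant that involve
    [A0] give the lower right entries one after the other. *)
Lemma degenerate_pid A1 A2 B0 B1 C (delta : k) : delta != 0 ->
  \det (qmx (pid_mx 1) A1 A2 B0 B1 C s t) = delta%:A ->
  degenerate (pid_mx 1) A1 A2 B0 B1.
Proof.
move=> nz_delta detM; set A0 : 'M[k]_2 := pid_mx 1 in detM *.
have A0E : (A0 0 0 = 1) * (A0 0 1 = 0) * (A0 1 0 = 0) * (A0 1 1 = 0).
  by rewrite !mxE.
have dA0 X : ddet A0 X = X 1 1.
  by rewrite /ddet !A0E mul1r mulr0 !mul0r mulr0 addr0 !subr0.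
have [[_ s1 s2 e13 e04] _ _ _] := det_qmx_coefs detM.
have simp := (mulr0, mul0r, mulrN, oppr0, addr0, add0r, subr0, sub0r).
move: s1 s2 e13 e04; rewrite !dA0 !det2E /ddet => s1.
rewrite s1 !simp addrC => /subr0_eq s2; rewrite s2 => e13 e04.
(* Now [A1 1 1 = 0] and [A2 1 1 = A1 0 1 * A1 1 0]. If either factor is zero, the remaining quartic
   coefficients kill the second row or the second column of the whole quadratic part. *)
have [q1_0|nz_q1] := eqVneq (A1 0 1) 0.
  move: s2 e13 e04; rewrite q1_0 !simp => s2.
  move=> /eqP; rewrite oppr_eq0 mulf_eq0 => e13 /eqP.
  rewrite oppr_eq0 mulf_eq0 => e04.
  have [q2_0|nz_q2] := eqVneq (A2 0 1) 0.
    apply: col1_degenerate => X; rewrite !inE.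
    by case/or3P => /eqP-> //; rewrite !A0E.
  move: e13 e04; rewrite (negPf nz_q2) /= => /eqP r1_0 /eqP r2_0.
  apply: row1_degenerate => X; rewrite !inE.
  by case/or3P => /eqP-> //; rewrite !A0E.
have [r1_0|nz_r1] := eqVneq (A1 1 0) 0.
  move: s2 e13; rewrite r1_0 !simp => s2.
  move=> /eqP; rewrite oppr_eq0 mulf_eq0 (negPf nz_q1) /= => /eqP r2_0.
  apply: row1_degenerate => X; rewrite !inE.
  by case/or3P => /eqP-> //; rewrite !A0E.
(* Translate so that the (0, 1) entry has no linear term. *)
pose b := - B0 0 1 / A1 0 1; pose a := - (B1 0 1 + b *+ 2 * A2 0 1) / A1 0 1.
apply: Or33; exists a, b.
have := det_qmx_subst (s + a%:A) (t + b%:A) detM; rewrite qmx_shift.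
set B0' := B0 + _ + _; set B1' := B1 + _ + _; set C' := C + _ + _ + _ + _ + _.
have q3 : B0' 0 1 = 0.
  by rewrite !mxE mulr0 addr0 /b mulfVK // addrN.
have q4 : B1' 0 1 = 0.
  by rewrite !mxE /a addrAC mulfVK // addrC addNr.
move=> /det_qmx_coefs[_ []]; rewrite !dA0 => s3 s4 e12 e03 [s5 _ _] [e10 e01 e00].
move: s4 e12 e03 s5 e10 e01 e00; rewrite !det2E /ddet s1 s2 s3 q3 q4.
rewrite !simp => s4 e12 e03 s5.
rewrite s5 !simp => e10 e01 e00.
(* Since [C' 1 1 = 0], the determinant of [C'] is minus the product of its antidiagonal entries. *)
have nz_q5 : C' 0 1 != 0 by apply: contra nz_delta => /eqP q5; rewrite -e00 q5 !simp.
have mul0 x y : x != 0 -> x * y = 0 -> y = 0 :> k.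
  by move=> nz_x /eqP; rewrite mulf_eq0 (negPf nz_x) => /eqP.
have r3 : B0' 1 0 = 0 by apply: (mul0 _ _ nz_q5); rewrite -[LHS]opprK e10 oppr0.
move: s4 e12 e03 e01; rewrite r3 !simp => s4; rewrite s4 !simp => e12 e03 e01.
have r4 : B1' 1 0 = 0 by apply: (mul0 _ _ nz_q5); rewrite -[LHS]opprK e01 oppr0.
(* This product is [A2 1 1], which multiplies [B0' 0 0] and [B1' 0 0] in the last two cubic
   coefficients. *)
have nz_s2 : A1 0 1 * A1 1 0 != 0 by rewrite mulf_neq0.
split; apply: mx2P => //; apply: (mul0 _ _ nz_s2); rewrite mulrC.
  by move: e12; rewrite r4 !simp.
by move: e03; rewrite r4 !simp.
Qed.

Lemma rank2_eq1 A : A != 0 -> \det A = 0 -> \rank A = 1%N.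
Proof.
move=> nzA detA; apply/eqP; rewrite eqn_leq lt0n mxrank_eq0 nzA andbT -ltnS.
rewrite ltn_neqAle rank_leq_row andbT -[_ == _]/(row_free A) row_free_unit unitmxE.
by rewrite detA unitr0.
Qed.

(** A nonzero singular [A0] has rank 1, so row and column operations bring it to [pid_mx 1]; they
    multiply the determinant by a nonzero constant. *)
Lemma degenerate_of_det_A0 A0 A1 A2 B0 B1 C (delta : k) : delta != 0 -> A0 != 0 ->
  \det (qmx A0 A1 A2 B0 B1 C s t) = delta%:A -> degenerate A0 A1 A2 B0 B1.
Proof.
move=> nz_delta nzA0 detM.
have [[detA0 _ _ _ _] _ _ _] := det_qmx_coefs detM.
pose P := invmx (col_ebase A0); pose Q := invmx (row_ebase A0).
have uP : P \in unitmx by rewrite unitmx_inv col_ebase_unit.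
have uQ : Q \in unitmx by rewrite unitmx_inv row_ebase_unit.
have PAQ : P *m A0 *m Q = pid_mx 1.
  rewrite -[X in _ *m X *m _](mulmx_ebase A0) (rank2_eq1 nzA0 detA0).
  rewrite -(mulmxA _ _ (row_ebase A0)).
  by rewrite mulKmx ?col_ebase_unit // mulmxK ?row_ebase_unit.
apply: (degenerate_equiv uP uQ); rewrite PAQ.
apply: (@degenerate_pid _ _ _ _ (P *m C *m Q) (\det P * delta * \det Q)).
  by rewrite !mulf_neq0 // -unitfE -unitmxE.
rewrite -PAQ -mul_qmx !det_mulmx !det_map_mx detM.
by rewrite -!in_algE !rmorphM.
Qed.

(** If [A0 = 0], exchange [s] and [t]. If also [A2 = 0], the coefficient of [s^2 t^2] gives
    [\det A1 = 0], hence a null row for [A1]. *)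
Lemma degenerate_of_det A0 A1 A2 B0 B1 C (delta : k) : delta != 0 ->
  \det (qmx A0 A1 A2 B0 B1 C s t) = delta%:A -> degenerate A0 A1 A2 B0 B1.
Proof.
move=> nz_delta detM.
have [A0_0|nzA0] := eqVneq A0 0; last exact: degenerate_of_det_A0 nz_delta nzA0 detM.
have [A2_0|nzA2] := eqVneq A2 0; last first.
  apply/degenerate_swap/(degenerate_of_det_A0 nz_delta nzA2 (C := C)).
  by rewrite qmx_swap; exact: det_qmx_subst.
have [[_ _ + _ _] _ _ _] := det_qmx_coefs detM.
rewrite A0_0 A2_0 /ddet !mxE !(mulr0, addr0, subr0) => /eqP/det0P[v nz_v vA1].
by apply: Or31; exists v => //; rewrite !mulmx0.
Qed.

End Trichotomy.

(** * Closed embeddings are injective on tangent vectors *)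

Section Immersion.

Variable k : fieldType.

Local Notation s := ('X_0 : {mpoly k[2]}).
Local Notation t := ('X_1 : {mpoly k[2]}).

(** The four matrix coordinates generate [k[SL_2]] as a [k]-algebra. *)
Lemma kSL2_ind (P : kSL2 k -> Prop) :
    (forall c, P c%:A) -> (forall a b, P a -> P b -> P (a + b)) ->
    (forall a b, P a -> P b -> P (a * b)) -> (forall i j, P (SL2_coord k i j)) ->
  forall a, P a.
Proof.
move=> Pc PD PM Pcoord a; have [p <-] := SL2_class_surj a.
elim/mpolyind: p => [|c m p _ _ IHp].
  by have := Pc 0; rewrite scale0r rmorph0.
rewrite rmorphD; apply: PD => //=; rewrite linearZ /= -mulr_algl.
apply: (PM) => //; rewrite mpolyXE_id rmorph_prod /=.
have P1 : P 1 by rewrite -[1]scale1r; exact: Pc.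
apply: (big_ind P P1 PM) => i _; rewrite rmorphXn /=.
elim: (m i) => [|n IHn]; first by rewrite expr0.
rewrite exprS; apply: (PM _ _ _ IHn) => {IHn}; rewrite -(inord_val i).
move: (Pcoord 0 1) (Pcoord 1 0) (Pcoord 0 0) (Pcoord 1 1).
by rewrite !mxE /=; case: i => [[|[|[|[|//]]]]].
Qed.

(* [p |-> (p (a + xi X, b + eta X))'(0)] is a derivation at the point [(a, b)];
   if it kills the entries of [rho] then it kills the whole image. *)
Lemma closed_embedding_immersion (rho : {lrmorphism kSL2 k -> {mpoly k[2]}})
    A0 A1 A2 B0 B1 C a b xi eta :
    closed_embedding rho -> mx_of_mor rho = qmx A0 A1 A2 B0 B1 C s t ->
    xi *: (B0 + (a *+ 2) *: A0 + b *: A1)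
      + eta *: (B1 + a *: A1 + (b *+ 2) *: A2) = 0 ->
  xi = 0 /\ eta = 0.
Proof.
move=> emb rhoE tangent.
pose h : {lrmorphism {mpoly k[2]} -> {poly k}} :=
  subst2 (a%:P + xi *: 'X) (b%:P + eta *: 'X).
pose D p := (h p)^`().[0].
have D0 p : D (rho p) = 0.
  elim/kSL2_ind: p => [c|p q Dp Dq|p q Dp Dq|i j].
  - by rewrite /D linearZ rmorph1 linearZ rmorph1 /= alg_polyC derivC horner0.
  - by rewrite /D !rmorphD /= derivD hornerD -[X in X + _]/(D _)
      -[X in _ + X]/(D _) Dp Dq addr0.
  - rewrite /D !rmorphM /= derivM hornerD !hornerM.
    rewrite -[(h (rho p))^`().[0]]/(D _) -[(h (rho q))^`().[0]]/(D _) Dp Dq.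
    by rewrite mulr0 mul0r addr0.
  - have -> : rho (SL2_coord k i j) = qmx A0 A1 A2 B0 B1 C s t i j.
      by rewrite -rhoE [RHS]mxE.
    have -> : D (qmx A0 A1 A2 B0 B1 C s t i j) =
        (qmx A0 A1 A2 B0 B1 C (a%:P + xi *: 'X) (b%:P + eta *: 'X) i j)^`().[0].
      by rewrite -[qmx _ _ _ _ _ _ (a%:P + _) _]subst2_qmx [in RHS]mxE.
    have tangent_ij : xi * (B0 i j + a *+ 2 * A0 i j + b * A1 i j)
        + eta * (B1 i j + a * A1 i j + b *+ 2 * A2 i j) = 0.
      by move/matrixP/(_ i j): tangent; rewrite !mxE.
    apply: etrans tangent_ij.
    rewrite qmxE !alg_polyC expr2 !(derivD, derivM, derivZ, derivX, derivC).
    rewrite !(hornerD, hornerM, hornerZ, hornerX, hornerC).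
    ring.
(* Surjectivity puts [s] and [t] in the image, where [D] vanishes, while [D s = xi] and
   [D t = eta]. *)
have [[p ps] [q qt]] := (emb s, emb t).
have hs : h s = a%:P + xi *: 'X := subst2_s _ _.
have ht : h t = b%:P + eta *: 'X := subst2_t _ _.
move: (D0 p) (D0 q); rewrite ps qt /D hs ht !(derivD, derivZ, derivX, derivC).
by rewrite !(hornerD, hornerZ, hornerC) !add0r !mulr1.
Qed.

End Immersion.

(** * Automorphisms of [SL_2] acting on embeddings *)

Section Reductions.

Variable k : fieldType.

Local Notation s := ('X_0 : {mpoly k[2]}).
Local Notation t := ('X_1 : {mpoly k[2]}).
Local Notation embedding := {lrmorphism kSL2 k -> {mpoly k[2]}}.
Local Notation coord := (SL2_coord k).
Local Notation const := (map_mx (in_alg {mpoly k[2]})).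

Implicit Type rho : embedding.

Definition normalizable rho : Prop :=
  exists lambda : k,
    lambda != 0 /\ equivalent_embeddings rho (rho_embedding lambda).

Definition reduces_to rho (N : 'M[{mpoly k[2]}]_2) : Prop :=
  exists rho' : embedding,
    [/\ mx_of_mor rho' = N, closed_embedding rho'
      & normalizable rho' -> normalizable rho].

Lemma reduces_to_aut rho (phi : {lrmorphism kSL2 k -> kSL2 k}) :
  bijective phi -> closed_embedding rho ->
  reduces_to rho (map_mx rho (mx_of_mor phi)).
Proof.
move=> bij_phi emb; have [psi phiK psiK] := bij_phi.
exists (rho \o phi : {lrmorphism _ -> _}); split.
- by apply/matrixP => i j; rewrite !mxE.
- by move=> p; have [q <-] := emb p; exists (psi q); rewrite /= psiK.
- case=> lambda [nz_lambda [phi' [bij_phi' eq_rho]]]; exists lambda; split=> //.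
  exists (phi \o phi' : {lrmorphism _ -> _}); split; first exact: bij_comp.
  by move=> a; rewrite eq_rho.
Qed.

(** By [mx_of_mor_inj], two endomorphisms are mutually inverse as soon as they are so on the
    coordinate matrix. *)
Lemma bijective_of_mx (phi psi : {lrmorphism kSL2 k -> kSL2 k}) :
  map_mx phi (mx_of_mor psi) = coord -> map_mx psi (mx_of_mor phi) = coord ->
  bijective phi.
Proof.
have id_of_mx (f g : {lrmorphism kSL2 k -> kSL2 k}) :
    map_mx f (mx_of_mor g) = coord -> cancel g f.
  move=> fg; pose h : {lrmorphism kSL2 k -> kSL2 k} := f \o g.
  pose i : {lrmorphism kSL2 k -> kSL2 k} := idfun.
  apply: (@mx_of_mor_inj k _ h i); rewrite [RHS]map_mx_id // -fg.
  by apply/matrixP => i' j; rewrite !mxE.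
by move=> phi_psi psi_phi; exists psi; apply: id_of_mx.
Qed.

(** Substituting [coord *m U] for [coord] is undone by substituting [coord *m V], even for
    nonconstant [U], provided each substitution fixes the other factor. *)
Lemma reduces_to_right_mul rho (U V : 'M[kSL2 k]_2) :
    \det U = 1 -> U *m V = 1%:M -> closed_embedding rho ->
    (forall phi : {lrmorphism kSL2 k -> kSL2 k},
      mx_of_mor phi = coord *m U -> map_mx phi V = V) ->
    (forall psi : {lrmorphism kSL2 k -> kSL2 k},
      mx_of_mor psi = coord *m V -> map_mx psi U = U) ->
  reduces_to rho (mx_of_mor rho *m map_mx rho U).
Proof.
move=> detU UV emb fixV fixU; have VU := mulmx1C UV.
have detV : \det V = 1.
  by rewrite -[LHS]mul1r -detU -det_mulmx UV det1.
have detP : \det (coord *m U) = 1 by rewrite det_mulmx det_SL2_coord detU mulr1.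
have detQ : \det (coord *m V) = 1 by rewrite det_mulmx det_SL2_coord detV mulr1.
have phiE := mx_of_morK detP; have psiE := mx_of_morK detQ.
rewrite -map_mxM -phiE; apply: reduces_to_aut => //.
apply: (@bijective_of_mx _ (mor_of_mx detQ)).
  rewrite psiE map_mxM fixV // -[map_mx _ coord]/(mx_of_mor _) phiE.
  by rewrite -mulmxA UV mulmx1.
rewrite phiE map_mxM fixU // -[map_mx _ coord]/(mx_of_mor _) psiE.
by rewrite -mulmxA VU mulmx1.
Qed.

Lemma reduces_to_const rho (Q : 'M[k]_2) : \det Q = 1 -> closed_embedding rho ->
  reduces_to rho (mx_of_mor rho *m const Q).
Proof.
move=> detQ emb.
have fix_const (A : comAlgType k) (f : {lrmorphism kSL2 k -> A}) (R : 'M[k]_2) :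
    map_mx f (map_mx (in_alg (kSL2 k)) R) = map_mx (in_alg A) R.
  by apply/matrixP => i j; rewrite !mxE rmorph_alg.
rewrite -(fix_const _ rho).
apply: (@reduces_to_right_mul _ _ (map_mx (in_alg (kSL2 k)) (\adj Q))) => //.
- by rewrite det_map_mx detQ rmorph1.
- by rewrite -map_mxM mul_mx_adj detQ map_mx1.
- by move=> phi _; exact: fix_const.
- by move=> psi _; exact: fix_const.
Qed.

Lemma reduces_to_tr rho : closed_embedding rho -> reduces_to rho (mx_of_mor rho)^T.
Proof.
move=> emb; have detT : \det coord^T = 1 by rewrite det_tr det_SL2_coord.
rewrite matrix.map_trmx -(mx_of_morK detT); apply: reduces_to_aut => //.
have trK : map_mx (mor_of_mx detT) (mx_of_mor (mor_of_mx detT)) = coord.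
  rewrite mx_of_morK -matrix.map_trmx -[map_mx _ coord]/(mx_of_mor _).
  by rewrite mx_of_morK trmxK.
exact: (bijective_of_mx trK trK).
Qed.

Lemma mul_mx2 (R : comNzRingType) (a b c d a' b' c' d' : R) :
  mx2 a b c d *m mx2 a' b' c' d' =
  mx2 (a * a' + b * c') (a * b' + b * d') (c * a' + d * c') (c * b' + d * d').
Proof. by rewrite [LHS]mx2E !mxE !big_ord_recl !big_ord0 !addr0 !mxE. Qed.

(** An upper unitriangular factor on the right keeps the first column. The multiplier depends only
    on the entry [(1, 0)], so it is fixed and the opposite shear is the inverse. *)
Lemma reduces_to_shear rho (c d : k) : closed_embedding rho ->
  reduces_to rho
    (mx_of_mor rho *m mx2 1 (c *: mx_of_mor rho 1 0 + d%:A) 0 1).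
Proof.
move=> emb; pose g := c *: coord 1 0 + d%:A; pose U h := mx2 1 h 0 (1 : kSL2 k).
have mapU (A : comAlgType k) (f : {lrmorphism kSL2 k -> A}) h :
    map_mx f (U h) = mx2 1 (f h) 0 1.
  by rewrite [LHS]mx2E !mxE /= rmorph1 rmorph0.
have -> : mx2 1 (c *: mx_of_mor rho 1 0 + d%:A) 0 1 = map_mx rho (U g).
  by rewrite mapU /g rmorphD /= linearZ rmorph_alg [mx_of_mor rho _ _]mxE.
have fix_g (f : {lrmorphism kSL2 k -> kSL2 k}) h :
    mx_of_mor f = coord *m U h -> f g = g.
  move=> fE; have : mx_of_mor f 1 0 = coord 1 0.
    by rewrite fE [coord in LHS]mx2E mul_mx2 mxE /= mulr1 mulr0 addr0.
  by rewrite mxE /g rmorphD /= linearZ rmorph_alg /= => ->.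
apply: (@reduces_to_right_mul _ _ (U (- g))) => //.
- by rewrite det_mx2 mulr1 mulr0 subr0.
- by rewrite mul_mx2 [RHS]mx2E !mxE /= !(mulr0, mul0r, mul1r, mulr1, addr0, add0r)
    addNr.
- by move=> phi /fix_g phi_g; rewrite mapU rmorphN /= phi_g.
- by move=> psi /fix_g psi_g; rewrite mapU psi_g.
Qed.

End Reductions.

(** * Embeddings with upper left entry 1 *)

Lemma affine_comb (k : fieldType) (A : comAlgType k) (a1 a2 a0 b1 b2 b0 c d : k)
    (x y : A) :
  a1 *: x + a2 *: y + a0%:A + c *: (b1 *: x + b2 *: y + b0%:A) + d%:A =
  (a1 + c * b1) *: x + (a2 + c * b2) *: y + (a0 + c * b0 + d)%:A.
Proof.
rewrite !scalerDr !scalerDl !scalerA (addrACA (a1 *: x + a2 *: y)).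
by rewrite (addrACA (a1 *: x)) -!addrA.
Qed.

Section NormalForm.

Variable k : fieldType.

Local Notation s := ('X_0 : {mpoly k[2]}).
Local Notation t := ('X_1 : {mpoly k[2]}).
Local Notation embedding := {lrmorphism kSL2 k -> {mpoly k[2]}}.

Implicit Type rho : embedding.

(** Quantifying over [rho] turns reductions of embeddings into operations on the pair [(a, b)]
    alone. *)
Definition unipotent_normalizable (a b : {mpoly k[2]}) : Prop :=
  forall rho, closed_embedding rho -> mx_of_mor rho = mx2 1 a b (1 + a * b) ->
  normalizable rho.

Lemma unipotent_swap a b :
  unipotent_normalizable b a -> unipotent_normalizable a b.
Proof.
move=> norm_ba rho emb rhoE; have [rho' [rho'E emb' norm_rho]] := reduces_to_tr emb.
apply/norm_rho/norm_ba => //; rewrite rho'E rhoE [LHS]mx2E !mxE /=.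
by rewrite mulrC.
Qed.

Lemma unipotent_shear c d a b :
  unipotent_normalizable (a + c *: b + d%:A) b -> unipotent_normalizable a b.
Proof.
move=> norm_ab rho emb rhoE.
have [rho' [rho'E emb' norm_rho]] := reduces_to_shear c d emb.
apply/norm_rho/norm_ab => //; rewrite rho'E rhoE mul_mx2 mxE /=.
rewrite !(mulr1, mulr0, mul1r, addr0); congr (mx2 1 _ _ _).
  by rewrite addrC addrA.
by rewrite -(addrA a) mulrDl addrCA (addrC (a * b)) (mulrC b).
Qed.

Definition affine2 (a1 a2 a0 : k) : {mpoly k[2]} := a1 *: s + a2 *: t + a0%:A.

Lemma unipotent_shear_affine c d a1 a2 a0 b1 b2 b0 :
  unipotent_normalizable (affine2 (a1 + c * b1) (a2 + c * b2) (a0 + c * b0 + d))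
    (affine2 b1 b2 b0) ->
  unipotent_normalizable (affine2 a1 a2 a0) (affine2 b1 b2 b0).
Proof.
move=> norm_ab; apply: (@unipotent_shear c d).
by rewrite /affine2 affine_comb.
Qed.

(** Gaussian elimination by shears and exchanges of the two entries. These preserve the determinant
    up to sign, so the final [lambda] is nonzero. *)
Lemma unipotent_affine a1 a2 a0 b1 b2 b0 : a1 * b2 - a2 * b1 != 0 ->
  unipotent_normalizable (affine2 a1 a2 a0) (affine2 b1 b2 b0).
Proof.

have shear_l := @unipotent_shear_affine.
have shear_r c d a1' a2' a0' b1' b2' b0' :
    unipotent_normalizable (affine2 a1' a2' a0')
      (affine2 (b1' + c * a1') (b2' + c * a2') (b0' + c * a0' + d)) ->
    unipotent_normalizable (affine2 a1' a2' a0') (affine2 b1' b2' b0').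
  by move/unipotent_swap/shear_l/unipotent_swap.
have norm_diag lambda : lambda != 0 ->
    unipotent_normalizable (affine2 0 1 0) (affine2 lambda 0 0).
  move=> nz_lambda rho emb rhoE; exists lambda; split=> //.
  exists (idfun : {lrmorphism _ -> _}); split; first by exists idfun.
  apply: (@mx_of_mor_inj _ _ (rho_embedding lambda) rho).
  rewrite mx_of_morK rhoE /affine2 /rho_mx.
  by rewrite !scale0r !add0r !addr0 scale1r -scalerAr mulrC.
have norm1 a1' a0' b1' b0' : b1' != 0 ->
    unipotent_normalizable (affine2 a1' 1 a0') (affine2 b1' 0 b0').
  move=> nz_b; apply: (shear_l (- a1' / b1') (- (a0' - a1' / b1' * b0'))).
  rewrite mulfVK // addrN mulr0 addr0 mulNr mulNr addrN.
  apply: (shear_r 0 (- b0')); rewrite !mul0r !addr0 addrN; exact: norm_diag.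
have norm2 a1' a0' b1' b2' b0' : b1' - b2' * a1' != 0 ->
    unipotent_normalizable (affine2 a1' 1 a0') (affine2 b1' b2' b0').
  move=> nz; apply: (shear_r (- b2') 0); rewrite mulr1 addrN.
  by apply: norm1; rewrite mulNr.
have norm3 a1' a2' a0' b1' b0' : a1' - a2' * b1' != 0 ->
    unipotent_normalizable (affine2 a1' a2' a0') (affine2 b1' 1 b0').
  by move=> nz; apply/unipotent_swap/norm2.
have norm4 a1' a2' a0' b1' b2' b0' : a2' != 0 -> a1' * b2' - a2' * b1' != 0 ->
    unipotent_normalizable (affine2 a1' a2' a0') (affine2 b1' b2' b0').
  (* This multiple of the first entry makes the coefficient of [t] in the second one equal to 1. *)
  move=> nz_a2 nz; apply: (shear_r ((1 - b2') / a2') 0).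
  rewrite mulfVK // addrCA addrN addr0.
  apply: norm3; apply: contra nz => /eqP eq0; apply/eqP; rewrite -[RHS]eq0.
  by field.
move=> nz; have [a2_0|nz_a2] := eqVneq a2 0; last exact: norm4.
(* Here [b2] is nonzero, so adding the second entry to the first gives the latter a nonzero
   coefficient of [t]. *)
apply: (shear_l 1 0); rewrite !mul1r; apply: norm4.
  by apply: contra nz; rewrite a2_0 add0r => /eqP->; rewrite !(mulr0, mul0r) subr0.
by apply: contra nz => /eqP eq0; apply/eqP; rewrite -[RHS]eq0; ring.
Qed.

End NormalForm.

(** * Normalization of quadratic embeddings *)

Lemma mxE_rV0 (R : nmodType) n (v : 'rV[R]_n) i : v = 0 -> v 0 i = 0.
Proof. by move=> ->; rewrite mxE. Qed.

Lemma mul_rV2 (R : comNzRingType) (v : 'rV[R]_2) n (X : 'M[R]_(2, n)) j :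
  (v *m X) 0 j = v 0 0 * X 0 j + v 0 1 * X 1 j.
Proof.
rewrite mxE big_ord_recl big_ord1.
by have -> : lift ord0 ord0 = 1 :> 'I_2 by exact: val_inj.
Qed.

Section QuadraticEmbeddings.

Variable k : fieldType.

Local Notation s := ('X_0 : {mpoly k[2]}).
Local Notation t := ('X_1 : {mpoly k[2]}).
Local Notation embedding := {lrmorphism kSL2 k -> {mpoly k[2]}}.

Implicit Type rho : embedding.

Lemma det_embedding rho A0 A1 A2 B0 B1 C :
  mx_of_mor rho = qmx A0 A1 A2 B0 B1 C s t ->
  \det (qmx A0 A1 A2 B0 B1 C s t) = 1%:A.
Proof. by move=> <-; rewrite det_mx_of_mor scale1r. Qed.

(** Here [f22 = 1 + f12 f21] with [f12] affine. Immersivity makes the linear parts of [f12] and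
    [f21] independent; the degree bound on [f22] then forces [f21] to be affine. *)
Lemma normalizable_f11_1 rho A0 A1 A2 B0 B1 C :
    closed_embedding rho -> mx_of_mor rho = qmx A0 A1 A2 B0 B1 C s t ->
    [/\ row 0 A0 = 0, row 0 A1 = 0 & row 0 A2 = 0] ->
    [/\ B0 0 0 = 0, B1 0 0 = 0 & C 0 0 = 1] ->
  normalizable rho.
Proof.
move=> emb rhoE [/rowP A0_0 /rowP A1_0 /rowP A2_0] [B0_00 B1_00 C_00].
have row0 : (A0 0 0 = 0) * (A0 0 1 = 0) * (A1 0 0 = 0) * (A1 0 1 = 0)
          * (A2 0 0 = 0) * (A2 0 1 = 0).
  by have := (A0_0 0, A0_0 1, A1_0 0, A1_0 1, A2_0 0, A2_0 1); rewrite !mxE.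
have simp := (mulr0, mul0r, oppr0, addr0, add0r, subr0, sub0r, mulr1, mul1r, mulrN).
have detM := det_embedding rhoE.
have [_ [e30 e21 e12 e03] _ [e10 e01 _]] := det_qmx_coefs detM.
move: e30 e21 e12 e03 e10 e01; rewrite /ddet !row0 B0_00 B1_00 C_00 !simp.
move=> e30 e21 e12 e03 e10 e01.
set N := mx2 (B0 0 1) (B0 1 0) (B1 0 1) (B1 1 0).
have nz_detN : \det N != 0.
  (* Such a [v] is a tangent vector at the origin along which [f12] and [f21] are stationary; the
     linear coefficients of the determinant make [f22] stationary too. *)
  apply/negP => /det0P[v nz_v vN].
  have vN_0 : v 0 0 * B0 0 1 + v 0 1 * B1 0 1 = 0.
    by rewrite -[RHS](mxE_rV0 0 vN) mul_rV2 !mxE.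
  have vN_1 : v 0 0 * B0 1 0 + v 0 1 * B1 1 0 = 0.
    by rewrite -[RHS](mxE_rV0 1 vN) mul_rV2 !mxE.
  have tangent : v 0 0 *: (B0 + (0 *+ 2) *: A0 + 0 *: A1)
      + v 0 1 *: (B1 + 0 *: A1 + (0 *+ 2) *: A2) = 0.
    rewrite !mul0rn !scale0r !addr0; apply: mx2P; rewrite !mxE //.
    - by rewrite B0_00 B1_00 !mulr0 addr0.
    - have eq11 : v 0 0 * B0 1 1 + v 0 1 * B1 1 1 =
          (v 0 0 * B0 0 1 + v 0 1 * B1 0 1) * C 1 0
          + (v 0 0 * B0 1 0 + v 0 1 * B1 1 0) * C 0 1
          + v 0 0 * (B0 1 1 - B0 0 1 * C 1 0 - C 0 1 * B0 1 0)
          + v 0 1 * (B1 1 1 - B1 0 1 * C 1 0 - C 0 1 * B1 1 0) by ring.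
      by rewrite eq11 vN_0 vN_1 e10 e01 !simp.
  have [v0 v1] := closed_embedding_immersion emb rhoE tangent.
  by case/eqP: nz_v; apply/rowP => i; rewrite mxE; case: (ord2P i) => ->.
(* The cubic part of the determinant is minus the linear part of [f12], which is nonzero, times the
   quadratic part of [f21]. *)
have A_10 : [/\ A0 1 0 = 0, A1 1 0 = 0 & A2 1 0 = 0].
  have mul0 x y : x != 0 -> - (x * y) = 0 -> y = 0 :> k.
    by move=> nz_x /eqP; rewrite oppr_eq0 mulf_eq0 (negPf nz_x) => /eqP.
  have [B0_01|nz_B0] := eqVneq (B0 0 1) 0; last first.
    have A0_10 := mul0 _ _ nz_B0 e30; rewrite A0_10 !simp in e21.
    have A1_10 := mul0 _ _ nz_B0 e21; rewrite A1_10 !simp in e12.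
    by split=> //; apply: mul0 nz_B0 e12.
  have nz_B1 : B1 0 1 != 0.
    by apply: contra nz_detN => /eqP B1_01; rewrite det_mx2 B0_01 B1_01 !simp.
  rewrite B0_01 !simp in e21 e12.
  by split; [apply: mul0 nz_B1 e21|apply: mul0 nz_B1 e12|apply: mul0 nz_B1 e03].
have{A_10} [A0_10 A1_10 A2_10] := A_10.
have nz_det : B0 0 1 * B1 1 0 - B1 0 1 * B0 1 0 != 0.
  by move: nz_detN; rewrite det_mx2 [B0 1 0 * _]mulrC.
have M_row i j : mx_of_mor rho i j = qmx A0 A1 A2 B0 B1 C s t i j by rewrite rhoE.
have M00 : mx_of_mor rho 0 0 = 1.
  by rewrite M_row qmxE !row0 B0_00 B1_00 C_00 !scale0r scale1r !simp.
have M01 : mx_of_mor rho 0 1 = affine2 (B0 0 1) (B1 0 1) (C 0 1).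
  by rewrite M_row qmxE !row0 !scale0r !simp !mulr_algr.
have M10 : mx_of_mor rho 1 0 = affine2 (B0 1 0) (B1 1 0) (C 1 0).
  by rewrite M_row qmxE A0_10 A1_10 A2_10 !scale0r !simp !mulr_algr.
apply: (unipotent_affine (a0 := C 0 1) (b0 := C 1 0) nz_det) => //.
rewrite [LHS]mx2E -M01 -M10 M00; congr (mx2 _ _ _ _).
by have /eqP := det_mx_of_mor rho; rewrite det2E M00 mul1r subr_eq => /eqP.
Qed.

Lemma col_SL2 (w : 'cV[k]_2) : w != 0 ->
  exists Q : 'M[k]_2, \det Q = 1 /\ col 0 Q = w.
Proof.
have colP' (Q : 'M[k]_2) : Q 0 0 = w 0 0 -> Q 1 0 = w 1 0 -> col 0 Q = w.
  by move=> Q0 Q1; apply/colP => i; rewrite mxE; case: (ord2P i) => ->.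
move=> nz_w; have [w0|nz_w0] := eqVneq (w 0 0) 0.
  exists (mx2 0 (- (w 1 0)^-1) (w 1 0) 0); split; last first.
    by apply: colP'; rewrite mxE.
  rewrite det_mx2 mul0r sub0r mulNr opprK mulVf //.
  apply: contra nz_w => /eqP w1; apply/eqP/colP => i; rewrite mxE.
  by case: (ord2P i) => ->.
exists (mx2 (w 0 0) 0 (w 1 0) (w 0 0)^-1); split; last by apply: colP'; rewrite mxE.
by rewrite det_mx2 mulfV // mul0r subr0.
Qed.

Lemma reduces_to_qmx rho A0 A1 A2 B0 B1 C Q : \det Q = 1 ->
    closed_embedding rho -> mx_of_mor rho = qmx A0 A1 A2 B0 B1 C s t ->
  reduces_to rho
    (qmx (A0 *m Q) (A1 *m Q) (A2 *m Q) (B0 *m Q) (B1 *m Q) (C *m Q) s t).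
Proof.
move=> detQ emb rhoE; have := reduces_to_const detQ emb; rewrite rhoE.
rewrite -[qmx A0 _ _ _ _ _ _ _](mul1mx) -(map_mx1 (in_alg {mpoly k[2]})) mul_qmx.
by rewrite !mul1mx.
Qed.

(** The affine first row has no zero, so its constant row is outside the span of its linear
    coefficients. Hence some [w] kills the latter and pairs to 1 with the former; as first column of
    [Q] it makes the upper left entry 1. *)
Lemma normalizable_row rho A0 A1 A2 B0 B1 C :
    closed_embedding rho -> mx_of_mor rho = qmx A0 A1 A2 B0 B1 C s t ->
    [/\ row 0 A0 = 0, row 0 A1 = 0 & row 0 A2 = 0] ->
  normalizable rho.
Proof.
move=> emb rhoE [A0_0 A1_0 A2_0]; have detM := det_embedding rhoE.
pose N := \matrix_(i < 2) (if i == 0 then row 0 B0 else row 0 B1).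
have NE u : u *m N = u 0 0 *: row 0 B0 + u 0 1 *: row 0 B1.
  by apply/rowP => j; rewrite mul_rV2 !mxE.
have C_N : ~~ (row 0 C <= N)%MS.
  apply/negP => /submxP[u]; rewrite NE => CE.
  (* The relation [row 0 C = u *m N] makes the first row vanish at this point. *)
  pose x : {mpoly k[2]} := - (u 0 0)%:A; pose y : {mpoly k[2]} := - (u 0 1)%:A.
  have row0 j : qmx A0 A1 A2 B0 B1 C x y 0 j = 0.
    have E0 (X : 'M[k]_2) : row 0 X = 0 -> X 0 j = 0 by move/rowP/(_ j); rewrite !mxE.
    rewrite qmxE (E0 _ A0_0) (E0 _ A1_0) (E0 _ A2_0) !scale0r !mulr0 !add0r.
    have -> : C 0 j = u 0 0 * B0 0 j + u 0 1 * B1 0 j.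
      by move/rowP/(_ j): CE; rewrite !mxE.
    by rewrite /x /y -!in_algE rmorphD !rmorphM !mulNr -opprD addNr.
  have /eqP := det_qmx_subst x y detM; rewrite det2E !row0 !mul0r subr0 scale1r.
  by rewrite eq_sym oner_eq0.
have [u uE] : exists u, row 0 C *m cokermx N = u by eexists.
rewrite submxE uE in C_N; have /rV0Pn[j nz_j] := C_N.
(* [N] kills every column of [cokermx N]; the scalar normalizes the pairing with [row 0 C]. *)
pose w := (u 0 j)^-1 *: col j (cokermx N).
have Nw : N *m w = 0.
  by rewrite /w -scalemxAr colE (mulmxA N) mulmx_coker mul0mx scaler0.
have Cw : row 0 C *m w = 1%:M.
  rewrite /w -scalemxAr [col j _]colE (mulmxA (row 0 C)) uE -colE.
  by apply/matrixP => i i'; rewrite !ord1 !mxE mulVf.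
have nz_w : w != 0.
  apply/eqP => w0; move/matrixP/(_ 0 0)/eqP: Cw.
  by rewrite w0 mulmx0 !mxE eq_sym oner_eq0.
have [Q [detQ Q_0]] := col_SL2 nz_w.
have [rho' [rho'E emb' norm_rho]] := reduces_to_qmx detQ emb rhoE.
have col0 X : (X *m Q) 0 0 = (row 0 X *m w) 0 0.
  by rewrite -Q_0 -row_mul colE mulmxA -colE !mxE.
have B0w : row 0 B0 *m w = 0 by have := row_mul 0 N w; rewrite rowK Nw row0.
have B1w : row 0 B1 *m w = 0 by have := row_mul 1 N w; rewrite rowK Nw row0.
apply/norm_rho/(normalizable_f11_1 emb' rho'E).
  by rewrite !row_mul A0_0 A1_0 A2_0 !mul0mx.
by rewrite !col0 B0w B1w Cw !mxE.
Qed.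

(** With [w] as first column of [Q], the first column of the product loses its quadratic part;
    transposition makes it the first row. *)
Lemma normalizable_col rho A0 A1 A2 B0 B1 C (w : 'cV[k]_2) :
    closed_embedding rho -> mx_of_mor rho = qmx A0 A1 A2 B0 B1 C s t ->
    w != 0 -> [/\ A0 *m w = 0, A1 *m w = 0 & A2 *m w = 0] ->
  normalizable rho.
Proof.
move=> emb rhoE nz_w [A0w A1w A2w]; have [Q [detQ Q_0]] := col_SL2 nz_w.
have [rho1 [rho1E emb1 norm_rho]] := reduces_to_qmx detQ emb rhoE.
have [rho2 [rho2E emb2 norm_rho1]] := reduces_to_tr emb1.
rewrite rho1E tr_qmx in rho2E.
apply/norm_rho/norm_rho1/(normalizable_row emb2 rho2E).
have row0 X : X *m w = 0 -> row 0 (X *m Q)^T = 0.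
  by move=> Xw; rewrite -tr_col colE -mulmxA -colE Q_0 Xw trmx0.
by split; apply: row0.
Qed.

End QuadraticEmbeddings.

Theorem proposition5p19 (k : fieldType)
    (rho : {lrmorphism kSL2 k -> {mpoly k[2]}}) :
  closed_embedding rho ->
  (forall i j : 'I_2, (msize (mx_of_mor rho i j) <= 3)%N) ->
  exists lambda : k,
    lambda != 0 /\ equivalent_embeddings rho (rho_embedding lambda).
Proof.
move=> emb /quad_qmx[A0 [A1 [A2 [B0 [B1 [C rhoE]]]]]]; rewrite -/(normalizable rho).
have [[v nz_v [vA0 vA1 vA2]]|[w nz_w Aw]|[a [b [eq0 eq1]]]] :=
  degenerate_of_det (oner_neq0 _) (det_embedding rhoE).
- have [rho' [rho'E emb' norm_rho]] := reduces_to_tr emb.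
  rewrite rhoE tr_qmx in rho'E; apply: norm_rho.
  apply: (normalizable_col emb' rho'E (w := v^T)); first by rewrite trmx_eq0.
  by rewrite -!trmx_mul vA0 vA1 vA2 trmx0.
- exact: normalizable_col emb rhoE nz_w Aw.
(* Both partial derivatives vanish at [(a, b)], so already the tangent vector [(1, 0)] gives a
   contradiction. *)
- have [] := closed_embedding_immersion (a := a) (b := b) (xi := 1) (eta := 0) emb rhoE.
    by rewrite eq0 eq1 !scaler0 addr0.
  by move/eqP; rewrite oner_eq0.
Qed.
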